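(* Given $c,q\in\mathbb Z_p$, the map $z\mapsto cz+q$ of $\mathbb Z_p$ into itself is an automaton function of a finite automaton if and only if $c,q\in\mathbb Z_p\cap\mathbb Q$. Given a finite automaton $\mathfrak A$ whose automaton function is $f(z)=cz+q$ for $c,q\in\mathbb Z_p\cap\mathbb Q$, represent $c,q$ as irreducible fractions $c=a/b$, $q=a'/b'$, where $a,a'\in\mathbb Z$, $b,b'\in\mathbb N$ and $\gcd(a,b)=\gcd(a',b')=\gcd(b,p)=\gcd(b',p)=1$. Then the limit plot $\mathbf{LP}(\mathfrak A)\subset\mathbb T^2$ is a link of $\mathrm{mult}_m p$ torus knots, where $m=b'/\gcd(b,b')$, and every knot of the link is a cable $\mathbf C(c,e)$ for $e\in\mathbf C(q)$: $$\mathbf{LP}(\mathfrak A)=\left\{\left(y\bmod1;(cy+e)\bmod1\right)\colon y\in\mathbb R,\ e\in\mathbf C(q)\right\}.$$ Moreover, for $e_1,e_2\in\mathbf C(q)$ one has $\mathbf C(c,e_1)=\mathbf C(c,e_2)$ if and only if $r_1\equiv r_2\pmod{\mathrm{mult}_m p}$, where $e_i=(-p^{r_i}q)\bmod1$, $i=1,2$.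
   Context: $p$ is a prime, $\mathbb F_p=\{0,1,\ldots,p-1\}$, $\mathbb N=\{1,2,\ldots\}$, $\mathbb N_0=\mathbb N\cup\{0\}$. $\mathbb Z_p\cap\mathbb Q$ is the set of rational numbers whose denominators in lowest terms are coprime to $p$. For $y\in\mathbb R$, $y\bmod 1=y-\lfloor y\rfloor$. For $z=\sum_{i\ge0}\alpha_ip^i\in\mathbb Z_p$ ($\alpha_i\in\mathbb F_p$), $z\bmod p^k=\sum_{i=0}^{k-1}\alpha_ip^i\in\{0,\ldots,p^k-1\}$. An automaton $\mathfrak A$ is a letter-to-letter transducer with input and output alphabet $\mathbb F_p$, a (possibly infinite) set of states $\mathcal S$, a transition function $S\colon\mathbb F_p\times\mathcal S\to\mathcal S$, an output function $O\colon\mathbb F_p\times\mathcal S\to\mathbb F_p$ and an initial state $s_0\in\mathcal S$; all states are assumed reachable from $s_0$. It is finite if $\mathcal S$ is finite. Its automaton function $f_{\mathfrak A}\colon\mathbb Z_p\to\mathbb Z_p$ sends $\sum_{i\ge0}\chi_ip^i$ to $\sum_{i\ge0}\xi_ip^i$, where $\xi_i=O(\chi_i,s_i)$, $s_{i+1}=S(\chi_i,s_i)$. The limit plot $\mathbf{LP}(\mathfrak A)$ is the set of all $(x;y)$ for which there exist $z\in\mathbb Z_p$ and a strictly increasing sequence $k_1<k_2<\cdots$ in $\mathbb N$ with $\lim_i (z\bmod p^{k_i})/p^{k_i}=x$ and $\lim_i (f_{\mathfrak A}(z)\bmod p^{k_i})/p^{k_i}=y$; here it is considered as a subset of $\mathbb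 T^2=\mathbb R^2/\mathbb Z^2$ by reducing coordinates modulo 1. The cable $\mathbf C(c,e)$ (two arguments) is $\{(y\bmod1;(cy+e)\bmod1)\colon y\in\mathbb R\}\subset\mathbb T^2$. For $q=a'/b'\in\mathbb Z_p\cap\mathbb Q$ in lowest terms, $\mathbf C(q)$ (one argument) is the finite set $\{(-p^\ell q)\bmod1\colon\ell\in\mathbb N_0\}=\{(-p^\ell q)\bmod1\colon\ell=0,1,\ldots,(\mathrm{mult}_{b'}p)-1\}$. For $k\in\mathbb N$ coprime to $p$, $\mathrm{mult}_kp$ is the multiplicative order of $p$ modulo $k$ if $k>1$, and $\mathrm{mult}_1p=1$. A torus knot is a smooth closed curve without self-intersections on $\mathbb T^2$; a link (of torus knots) is a finite collection of pairwise disjoint torus knots. *)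

(* Defs.v *)
From HB Require Import structures.
From mathcomp Require Import all_boot all_order all_fingroup all_algebra.
From mathcomp Require Import generic_quotient.
From mathcomp Require Import all_classical all_reals all_analysis.

Set Implicit Arguments.
Unset Strict Implicit.
Unset Printing Implicit Defensive.

Import Order.TTheory GRing.Theory Num.Theory.
Import numFieldNormedType.Exports.

Local Open Scope classical_set_scope.
Local Open Scope ring_scope.

(* p-adic integers as digit sequences, least significant digit first.  The
   digit type 'F_p is 'I_p only when p is prime; all uses assume this. *)
Definition padic_int (p : nat) : Type := nat -> 'F_p.

Section PadicIntegers.
Variable p : nat.
Implicit Types x y z : padic_int p.

(* z mod p^k *)
Definition zp_trunc z (k : nat) : nat := (\sum_(i < k) z i * p ^ i)%N.

(* The p-adic integer congruent to u k modulo p^k for every k, where u is a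
   coherent family of residues: u k.+1 = u k %[mod p ^ k]. *)
Definition zp_of_residues (u : nat -> nat) : padic_int p :=
  fun i => ((u i.+1 %/ p ^ i)%N)%:R.

Definition zp_add x y : padic_int p :=
  zp_of_residues (fun k => zp_trunc x k + zp_trunc y k)%N.

Definition zp_mul x y : padic_int p :=
  zp_of_residues (fun k => zp_trunc x k * zp_trunc y k)%N.

Lemma zp_truncS z k : zp_trunc z k.+1 = (zp_trunc z k + z k * p ^ k)%N.
Proof. exact: big_ord_recr. Qed.

Lemma zp_trunc_coherent z k : zp_trunc z k.+1 = zp_trunc z k %[mod p ^ k].
Proof. by rewrite zp_truncS addnC modnMDl. Qed.

Lemma zp_trunc_of_residues (u : nat -> nat) (k : nat) : prime p ->
    (forall j, u j.+1 = u j %[mod p ^ j]) ->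
  zp_trunc (zp_of_residues u) k = (u k %% p ^ k)%N.
Proof.
move=> p_pr u_coh; elim: k => [|k IHk].
  by rewrite /zp_trunc big_ord0 expn0 modn1.
rewrite zp_truncS IHk /zp_of_residues val_Fp_nat // -u_coh expnS.
rewrite modn_divl.
have -> : (u k.+1 %% p ^ k = u k.+1 %% (p * p ^ k) %% p ^ k)%N.
  by rewrite modn_dvdm // dvdn_mull.
by rewrite addnC -divn_eq.
Qed.

Lemma zp_trunc_add x y k : prime p ->
  zp_trunc (zp_add x y) k = ((zp_trunc x k + zp_trunc y k) %% p ^ k)%N.
Proof.
move=> p_pr; apply: zp_trunc_of_residues => // j.
by rewrite -modnDm !zp_trunc_coherent modnDm.
Qed.

Lemma zp_trunc_mul x y k : prime p ->
  zp_trunc (zp_mul x y) k = ((zp_trunc x k * zp_trunc y k) %% p ^ k)%N.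
Proof.
move=> p_pr; apply: zp_trunc_of_residues => // j.
by rewrite -modnMm !zp_trunc_coherent modnMm.
Qed.

(* r lies in Z_p and x is its image there, i.e. denq r * x = numq r in Z_p. *)
Definition zp_is_rat x (r : rat) : Prop :=
  coprime `|denq r|%N p /\
  forall k : nat,
    (denq r * (zp_trunc x k)%:Z = numq r %[mod (p ^ k)%N%:Z])%Z.

Definition zp_rational x : Prop := exists r : rat, zp_is_rat x r.

End PadicIntegers.

Record automaton (p : nat) := Automaton {
  aut_state : Type;
  aut_trans : 'F_p -> aut_state -> aut_state;
  aut_out : 'F_p -> aut_state -> 'F_p;
  aut_init : aut_state;
  aut_reachable : forall s : aut_state,
    exists w : seq 'F_p, foldl (fun t a => aut_trans a t) aut_init w = s
}.

Definition finite_automaton (p : nat) (A : automaton p) : Prop :=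
  finite_set [set: aut_state A].

Fixpoint aut_run (p : nat) (A : automaton p) (z : padic_int p) (i : nat) :
    aut_state A :=
  if i is j.+1 then aut_trans (z j) (aut_run A z j) else aut_init A.

Definition automaton_fun (p : nat) (A : automaton p) (z : padic_int p) :
    padic_int p :=
  fun i => aut_out (z i) (aut_run A z i).

(* Multiplicative order of p modulo k, equal to 1 for k = 1.  For k > 1 and
   p coprime to k, p%:R is a unit of 'Z_k and the insubd default is unused. *)
Definition mult_order (k p : nat) : nat :=
  if (1 < k)%N then #[insubd (1%g : {unit 'Z_k}) (p%:R : 'Z_k)]%g else 1%N.

Section Torus.
Variable R : realType.

Definition mod1 (y : R) : R := y - (Num.floor y)%:~R.

Definition torus_rel (u v : R * R) : bool :=
  (u.1 - v.1 \is a Num.int) && (u.2 - v.2 \is a Num.int).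

Lemma torus_rel_refl : reflexive torus_rel.
Proof. by move=> u; rewrite /torus_rel !subrr rpred0. Qed.

Lemma torus_rel_sym : symmetric torus_rel.
Proof. by move=> u v; rewrite /torus_rel !(rpredBC _ u.1) !(rpredBC _ u.2). Qed.

Lemma torus_rel_trans : transitive torus_rel.
Proof.
move=> v u w /andP[uv1 uv2] /andP[vw1 vw2]; apply/andP; split.
  by rewrite -(subrKA v.1) rpredD.
by rewrite -(subrKA v.2) rpredD.
Qed.

Canonical torus_equiv :=
  EquivRel torus_rel torus_rel_refl torus_rel_sym torus_rel_trans.

(* R^2 / Z^2 *)
Definition torus := {eq_quot torus_equiv}%qT.

Definition torus_pt (u : R * R) : torus := (\pi_({eq_quot torus_equiv}) u)%qT.

Lemma torus_ptP (u v : R * R) : torus_pt u = torus_pt v <-> torus_rel u v.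
Proof. by split=> [/eqmodP|uv] //; apply/eqmodP. Qed.

Lemma torus_pt_mod1 (x y : R) : torus_pt (mod1 x, mod1 y) = torus_pt (x, y).
Proof.
apply/torus_ptP; rewrite /torus_rel /mod1 /=.
by rewrite (addrC x) (addrC y) !addrK !rpredN !intr_int.
Qed.

Definition smooth (g : R -> R) : Prop :=
  forall (n : nat) (t : R), derivable (derive1n n g) t 1.

(* Smooth immersion of the line into R^2 / Z^2; since the projection is a local
   diffeomorphism, this is tested on local lifts to the plane. *)
Definition smooth_immersion (gamma : R -> torus) : Prop :=
  forall t0 : R, exists g1 g2 : R -> R,
    [/\ smooth g1, smooth g2,
        (derive1 g1 t0, derive1 g2 t0) <> (0, 0) &
        \forall t \near t0, gamma t = torus_pt (g1 t, g2 t)].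

(* The image of a curve parametrized by the circle R / Z, on which the curve is
   well defined and injective. *)
Definition torus_knot (K : set torus) : Prop :=
  exists gamma : R -> torus,
    [/\ smooth_immersion gamma,
        (forall s t : R, gamma s = gamma t <-> s - t \is a Num.int) &
        K = range gamma].

Definition torus_link (n : nat) (K : 'I_n -> set torus) : Prop :=
  (forall i, torus_knot (K i)) /\
  (forall i j, i <> j -> K i `&` K j = set0).

Definition limit_plot_plane (p : nat) (A : automaton p) : set (R * R) :=
  [set u | exists (z : padic_int p) (k : nat -> nat),
    [/\ (forall i, (0 < k i)%N),
        {homo k : i j / (i < j)%N},
        (fun i => (zp_trunc z (k i))%:R / (p ^ k i)%N%:R : R) @ \oo --> u.1 &
        (fun i => (zp_trunc (automaton_fun A z) (k i))%:R / (p ^ k i)%N%:R : R)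
          @ \oo --> u.2]].

Definition limit_plot (p : nat) (A : automaton p) : set torus :=
  torus_pt @` limit_plot_plane A.

Definition cable (c e : R) : set torus :=
  [set P | exists y : R, P = torus_pt (mod1 y, mod1 (c * y + e))].

(* The one-argument C(q). *)
Definition cable_shifts (p : nat) (q : rat) : set R :=
  [set e | exists l : nat, e = mod1 (- (p%:R ^+ l * ratr q))].

End Torus.

Arguments limit_plot_plane R {p} A.
Arguments limit_plot R {p} A.
Arguments cable_shifts R p q : clear implicits.

(* Main.v *)
Require Import Defs.
From mathcomp Require Import all_boot all_order all_fingroup all_algebra.
From mathcomp Require Import cyclic.
From mathcomp Require Import all_classical all_reals all_analysis.
From mathcomp Require Import zify ring lra.

Set Implicit Arguments.
Unset Strict Implicit.
Unset Printing Implicit Defensive.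

Import Order.TTheory GRing.Theory Num.Theory.
Import numFieldNormedType.Exports.

Local Open Scope classical_set_scope.
Local Open Scope ring_scope.

(** Why the theorem holds.

   Everything rests on one congruence. If c = a/b and q = a'/b' with
   denominators prime to p, then w = c z + q satisfies, at every precision k,
     b b' w_k = a b' z_k + a' b   modulo p^k,
   where u_k abbreviates u mod p^k (zp_affine_trunc).

   Finite automata. Read the congruence digit by digit, with a common
   denominator D: the quotient of D c z_k + D q - D w_k by p^k is a carry, it
   determines the next output digit, and it stays bounded because each step
   divides it by p up to a bounded error. So finitely many carries are enough
   (affine_finite_automaton). Conversely, on the inputs 0 and 1, all of whose
   digits but the first vanish, a finite automaton repeats a state, hence
   outputs eventually periodic digits, that is a rational number
   (zp_rational_periodic); those two outputs are q and c + q.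

   The limit plot. Divide the congruence by b' p^k: for some integer t,
     b (w_k / p^k) - a (z_k / p^k) = (a' b / b') / p^k + t / b'.
   The integer t satisfies p^k t = - a' b modulo b', so t / b' agrees modulo 1
   with - b p^l q for any l with p^(k+l) = 1 modulo b'. A convergent sequence of
   integers attains its limit, so a limit point (x, y) satisfies
     b (y + p^l q) - a x  integral for some l.
   By cableP this integrality says that (x, y) lies on the cable C(c, - p^l q),
   whence one inclusion (limit_plot_sub_cables). For the other inclusion, the
   digits of z are chosen block by block (approx_padic): a long new block
   moves z_k / p^k close to x and, up to a correction of size at most 2b, puts
   z_k in a prescribed class modulo b; that class selects among the b strands
   of the cable over x. The ordinates only need to converge modulo 1, so a
   convergent subsequence is extracted in [0, 1] (cables_sub_limit_plot).

   Counting the knots. Two cables C(c, e1) and C(c, e2) that meet coincide, and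
   this happens exactly when b (e1 - e2) is an integer. For e_i = - p^(r_i) q this
   means that b' divides b a' (p^r1 - p^r2), that is, m = b' / gcd(b, b') divides
   p^r1 - p^r2, that is, r1 = r2 modulo the order of p modulo m
   (shift_diff_int). Each cable is a knot: it is parametrized by
   t |-> (b t, a t + e), which is injective modulo 1 because a and b are coprime
   (torus_knot_cable). *)

(** * Congruences *)

Lemma eqz_modP (d m n : int) : (m = n %[mod d])%Z <-> (d %| m - n)%Z.
Proof. by rewrite -eqz_mod_dvd; split=> [->|/eqP]. Qed.

Lemma coprimez_expr_prime (p : nat) (D : int) (k : nat) :
  coprime `|D| p -> coprimez (p ^ k)%N D.
Proof.
by move=> co; apply: (@coprimeXl k p `|D|%N); rewrite coprime_sym.
Qed.

Lemma Fp_ltn (p : nat) (x : 'F_p) : prime p -> (x < p)%N.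
Proof. by move=> p_prime; rewrite -[X in (_ < X)%N](Fp_cast p_prime) ltn_ord. Qed.

Lemma coprime_solve (a : int) (b : nat) (v : int) : (0 < b)%N -> coprime `|a| b ->
  exists2 u : nat, (u < b)%N & (b %| a * u%:Z - v)%Z.
Proof.
move=> b0 co.
have /coprimezP[[x y] /= xy1] : coprimez a b by [].
have bn0 : b%:Z != 0 by lia.
exists `|((x * v) %% b)%Z|%N.
  by rewrite -ltz_nat gez0_abs ?modz_ge0 // ltz_pmod.
rewrite gez0_abs ?modz_ge0 //.
have /dvdzP[t tE] : (b %| ((x * v) %% b)%Z - x * v)%Z.
  by apply/eqz_modP; rewrite modz_mod.
apply/dvdzP; exists (a * t - y * v).
have -> : ((x * v) %% b)%Z = x * v + t * b by rewrite -tE; ring.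
rewrite -[X in _ - X]mul1r -xy1; ring.
Qed.

Lemma mult_order_gt0 (k p : nat) : (0 < mult_order k p)%N.
Proof. by rewrite /mult_order; case: ifP => // _; exact: order_gt0. Qed.

Lemma mult_orderP (k p i j : nat) : (0 < k)%N -> coprime k p ->
  (k %| (p ^ i)%N%:Z - (p ^ j)%N%:Z)%Z <-> i = j %[mod mult_order k p].
Proof.
move=> k0 co; rewrite /mult_order; case: ltnP => [k1|k1]; last first.
  have -> : k = 1%N by lia.
  by rewrite dvd1z !modn1.
set u := insubd _ _.
have uE : val u = p%:R :> 'Z_k by rewrite insubdK // -topredE /= unitZpE.
have uX n : val (u ^+ n)%g = (p ^ n)%:R :> 'Z_k.
  by rewrite natrX -uE; elim: n => // n; rewrite expgS exprS /= => ->.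
have -> : (k %| (p ^ i)%N%:Z - (p ^ j)%N%:Z)%Z = (u ^+ i == u ^+ j)%g.
  rewrite -(inj_eq val_inj) !uX -(inj_eq val_inj) /= !val_Zp_nat //.
  by rewrite -eqz_mod_dvd !modz_nat eqz_nat.
by rewrite eq_expg_mod_order; split=> /eqP.
Qed.

(** * Rational numbers among the p-adic integers *)

Section PadicFractions.
Variables (p : nat) (p_prime : prime p).
Implicit Types (x y z : padic_int p) (D C : int).

Lemma zp_trunc_lt z k : (zp_trunc z k < p ^ k)%N.
Proof.
elim: k => [|k IHk]; first by rewrite /zp_trunc big_ord0 expn0.
by have := Fp_ltn (z k) p_prime; rewrite zp_truncS expnS; nia.
Qed.

Lemma zp_eq_trunc x y : (forall k, zp_trunc x k = zp_trunc y k) -> x = y.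
Proof.
move=> exy; apply/funext => i; apply: val_inj => /=.
have := exy i.+1; rewrite !zp_truncS exy => /eqP; rewrite eqn_add2l eqn_pmul2r.
  by move/eqP.
by rewrite expn_gt0 prime_gt0.
Qed.

Lemma zp_trunc_dvdB z j k : (j <= k)%N ->
  ((p ^ j)%N %| (zp_trunc z k)%:Z - (zp_trunc z j)%:Z)%Z.
Proof.
elim: k => [|k IHk]; first by rewrite leqn0 => /eqP ->; rewrite subrr dvdz0.
rewrite leq_eqVlt => /predU1P[->|]; first by rewrite subrr dvdz0.
rewrite ltnS => jk; rewrite zp_truncS PoszD addrAC rpredD ?IHk //.
by rewrite dvdzE /= dvdn_mull // dvdn_exp2l.
Qed.

(** D may be cancelled modulo p^k, being prime to p; so a relation
   D x = C determines x. *)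
Lemma zp_eq_scaled D x y : coprime `|D| p ->
    (forall k, ((p ^ k)%N %| D * ((zp_trunc x k)%:Z - (zp_trunc y k)%:Z))%Z) ->
  x = y.
Proof.
move=> co exy; apply: zp_eq_trunc => k; have := exy k.
rewrite Gauss_dvdzr ?coprimez_expr_prime // -eqz_mod_dvd !modz_nat eqz_nat.
by rewrite !modn_small ?zp_trunc_lt // => /eqP.
Qed.

(** The equation D x = C in Z_p. The fraction C/D may be reducible, so that
   several rational numbers can be brought to a common denominator. *)
Definition zp_solves x D C : Prop :=
  forall k, ((p ^ k)%N %| D * (zp_trunc x k)%:Z - C)%Z.

Lemma zp_is_rat_solves x (r : rat) D C :
  zp_is_rat x r -> C * denq r = numq r * D -> zp_solves x D C.
Proof.
move=> [co xr] eCD k; rewrite -(Gauss_dvdzr _ (coprimez_expr_prime k co)).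
have /eqz_modP := xr k; rewrite mulrBr mulrCA [_ * C]mulrC eCD [_ * D]mulrC -mulrBr.
exact: dvdz_mull.
Qed.

Lemma zp_rationalP x :
  zp_rational x <-> exists D C, coprime `|D| p /\ zp_solves x D C.
Proof.
split=> [[r xr]|[D [C [co xDC]]]].
  exists (denq r), (numq r); split; first by case: xr.
  by apply: zp_is_rat_solves xr _; rewrite mulrC.
have D0 : D != 0.
  apply: contraTneq co => ->; rewrite /coprime gcd0n.
  by rewrite gtn_eqF // prime_gt1.
pose r : rat := C%:~R / D%:~R.
have eCD : C * denq r = numq r * D.
  apply/eqP; rewrite -(eqr_int rat) !rmorphM /=.
  have Dq : D%:~R != 0 :> rat by rewrite intr_eq0.
  have dq : (denq r)%:~R != 0 :> rat by rewrite intr_eq0 denq_eq0.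
  by rewrite -eqr_div // divq_num_den.
exists r; split.
  apply: coprime_dvdl co.
  rewrite -[(_ %| _)%N]/(denq r %| D)%Z.
  rewrite -(Gauss_dvdzr (m := denq r) (n := numq r)); last first.
    rewrite coprimez_sym /coprimez.
    by have := coprime_num_den r; rewrite /coprime /gcdz => /eqP ->.
  by rewrite -eCD dvdz_mull.
move=> k; apply/eqz_modP; rewrite -(Gauss_dvdzr _ (coprimez_expr_prime k co)).
have -> : D * (denq r * (zp_trunc x k)%:Z - numq r) =
    denq r * (D * (zp_trunc x k)%:Z - C).
  by rewrite mulrBr [denq r * (_ - _)]mulrBr [denq r * C]mulrC eCD; ring.
exact: dvdz_mull.
Qed.

(** The congruence relating input and output of z |-> c z + q at finite
   precision, on which both halves of the theorem depend. *)
Lemma zp_affine_trunc D al be (c q z : padic_int p) k :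
  zp_solves c D al -> zp_solves q D be ->
  ((p ^ k)%N %| D * (zp_trunc (zp_add (zp_mul c z) q) k)%:Z
                - (al * (zp_trunc z k)%:Z + be))%Z.
Proof.
move=> /(_ k)/dvdzP[u uE] /(_ k)/dvdzP[v vE].
rewrite zp_trunc_add // zp_trunc_mul // modnDml -modz_nat PoszD PoszM.
set ck := (zp_trunc c k)%:Z in uE *; set qk := (zp_trunc q k)%:Z in vE *.
set zk := (zp_trunc z k)%:Z; set P := (p ^ k)%N%:Z.
have /dvdzP[t tE] : (P %| ((ck * zk + qk) %% P)%Z - (ck * zk + qk))%Z.
  by apply/eqz_modP; rewrite modz_mod.
apply/dvdzP; exists (D * t + u * zk + v).
have -> : ((ck * zk + qk) %% P)%Z = t * P + (ck * zk + qk) by rewrite -tE; ring.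
have -> : al = D * ck - u * P by rewrite -uE; ring.
have -> : be = D * qk - v * P by rewrite -vE; ring.
ring.
Qed.

(** Digits of period n from rank N on: shifting by n digits changes the
   truncations by a constant, so (1 - p^n) x is an integer, and 1 - p^n is
   prime to p. *)
Lemma zp_rational_periodic x N n : (0 < n)%N ->
  (forall i, (N <= i)%N -> x (i + n)%N = x i) -> zp_rational x.
Proof.
move=> n0 per; apply/zp_rationalP.
pose C : int := (zp_trunc x (N + n))%:Z - (p ^ n)%N%:Z * (zp_trunc x N)%:Z.
have CE k : (N <= k)%N ->
    (zp_trunc x (k + n))%:Z - (p ^ n)%N%:Z * (zp_trunc x k)%:Z = C.
  elim: k => [|k IHk]; first by rewrite leqn0 => /eqP N0; rewrite /C N0.
  rewrite leq_eqVlt => /predU1P[<- //|]; rewrite ltnS => Nk.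
  rewrite addSn !zp_truncS per // -(IHk Nk) expnD.
  by rewrite !PoszD !PoszM mulrDr; ring.
exists (1 - (p ^ n)%N%:Z), C; split.
  suff: coprimez (1 - (p ^ n)%N%:Z) p by [].
  apply/coprimezP; exists (1, (p ^ n.-1)%N%:Z) => /=.
  by rewrite mul1r -PoszM -expnSr prednK // subrK.
have main k : (N <= k)%N ->
    ((p ^ k)%N %| (1 - (p ^ n)%N%:Z) * (zp_trunc x k)%:Z - C)%Z.
  move=> Nk; have := zp_trunc_dvdB x (leq_addr n k).
  rewrite -rpredN -(CE k Nk); congr (_ %| _)%Z; ring.
move=> k; case: (leqP N k) => [/main//|kN].
have := zp_trunc_dvdB x (ltnW kN); set d := (_ - _ : int) => dvd_d.
have -> : (1 - (p ^ n)%N%:Z) * (zp_trunc x k)%:Z - C =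
   (1 - (p ^ n)%N%:Z) * (zp_trunc x N)%:Z - C - (1 - (p ^ n)%N%:Z) * d.
  by rewrite /d; ring.
rewrite rpredB ?dvdz_mull //.
by apply: dvdz_trans (main N (leqnn N)); rewrite dvdzE /= dvdn_exp2l // ltnW.
Qed.

End PadicFractions.

(** * Automata computing affine functions *)

(** Restricting a transducer to its reachable states, as the definition of
   automata demands, does not change its function. *)
Section ReachablePart.
Variables (p : nat) (X : Type) (trans : 'F_p -> X -> X) (out : 'F_p -> X -> 'F_p).
Variable init : X.

Definition reachable (s : X) : Prop :=
  exists w : seq 'F_p, foldl (fun t a => trans a t) init w = s.

Lemma reachable_trans a s : reachable s -> reachable (trans a s).
Proof. by move=> [w ws]; exists (rcons w a); rewrite foldl_rcons ws. Qed.

Definition reachable_state : Type := {s : X | reachable s}.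

Definition reachable_step (a : 'F_p) (s : reachable_state) : reachable_state :=
  exist _ (trans a (sval s)) (reachable_trans a (proj2_sig s)).

Definition reachable_init : reachable_state :=
  exist _ init (ex_intro _ [::] erefl).

Lemma reachable_step_surj (s : reachable_state) : exists w : seq 'F_p,
  foldl (fun t a => reachable_step a t) reachable_init w = s.
Proof.
case: s => s sr; have [w ws] := sr; exists w; apply: eq_sig_hprop => /=.
  by move=> x; exact: Prop_irrelevance.
rewrite -ws; elim/last_ind: w {ws} => // w a IHw.
by rewrite !foldl_rcons /= IHw.
Qed.

Definition reachable_automaton : automaton p :=
  Automaton (fun a (s : reachable_state) => out a (sval s)) reachable_step_surj.

Fixpoint orbit_state (z : padic_int p) (i : nat) : X :=
  if i is j.+1 then trans (z j) (orbit_state z j) else init.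

Lemma aut_run_reachable z i :
  sval (aut_run reachable_automaton z i) = orbit_state z i.
Proof. by elim: i => //= i ->. Qed.

End ReachablePart.

Section AffineAutomata.
Variables (p : nat) (p_prime : prime p).

(** The state is the carry t of the division by D performed digit by digit:
   after k steps with input z and output y,
   D (y mod p^k) + p^k t = al (z mod p^k) + be.
   The carry stays bounded, because one step divides it by p up to a bounded
   error; this is where finiteness comes from. *)
Lemma affine_finite_automaton D al be (c q : padic_int p) :
    coprime `|D| p -> zp_solves c D al -> zp_solves q D be ->
  exists A : automaton p, finite_automaton A /\
    forall z, automaton_fun A z = zp_add (zp_mul c z) q.
Proof.
move=> co cE qE.
have p0 := prime_gt0 p_prime.
(* D is invertible modulo p: exactly one digit clears the last digit of the carry *)
have digit (u : 'F_p * int) : exists x : 'F_p,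
    (p %| al * (u.1 : nat)%:Z + u.2 - D * (x : nat)%:Z)%Z.
  case: u => a t /=.
  have [d dp dvd_d] := coprime_solve (al * (a : nat)%:Z + t) p0 co.
  by exists d%:R; rewrite val_Fp_nat // modn_small // -rpredN opprB.
have [xi xiP] := choice digit.
pose trans (a : 'F_p) (t : int) : int :=
  ((al * (a : nat)%:Z + t - D * (xi (a, t) : nat)%:Z) %/ p)%Z.
have transE a t : trans a t * p = al * (a : nat)%:Z + t - D * (xi (a, t) : nat)%:Z.
  by rewrite divzK // (xiP (a, t)).
pose A := reachable_automaton trans (fun a t => xi (a, t)) be.
exists A; split; last first.
  move=> z; apply: (zp_eq_scaled p_prime co) => k.
  have inv : D * (zp_trunc (automaton_fun A z) k)%:Z
      + orbit_state trans be z k * (p ^ k)%N = al * (zp_trunc z k)%:Z + be.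
    elim: k => [|k IHk]; first by rewrite /zp_trunc !big_ord0 expn0 /=; ring.
    have fk : automaton_fun A z k = xi (z k, orbit_state trans be z k).
      by rewrite /automaton_fun /= aut_run_reachable.
    rewrite !zp_truncS fk expnS !PoszD !PoszM /=.
    rewrite [trans _ _ * _]mulrA transE mulrDr [al * (_ + _)]mulrDr addrAC.
    by rewrite [_ + be]addrAC -IHk; ring.
  have /dvdzP[u uE] := zp_affine_trunc p_prime z k cE qE.
  apply/dvdzP; exists (- orbit_state trans be z k - u).
  by rewrite mulrBl -uE -inv; ring.
(* any bound of at least |al| + |D| is stable under one step; the summand |be|
   accounts for the initial carry *)
pose B : int := `|al| + `|D| + `|be|.
have bound t a : `|t| <= B -> `|trans a t| <= B.
  move=> tB; have := transE a t.
  have ap : (a < p)%N by apply: Fp_ltn.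
  have xp : (xi (a, t) < p)%N by apply: Fp_ltn.
  have p1 := prime_gt1 p_prime.
  move: (trans a t) (xi (a, t) : nat) xp (a : nat) ap => s x xp a' ap sE.
  have : `|s| * p%:Z <= `|al| * a'%:Z + `|t| + `|D| * x%:Z.
    rewrite -[p%:Z]/(`|p%:Z|) -normrM sE.
    rewrite (le_trans (ler_normB _ _)) // lerD ?normrM //.
    by rewrite (le_trans (ler_normD _ _)) // normrM.
  have b0 := normr_ge0 be; have a0 := normr_ge0 al; have d0 := normr_ge0 D.
  have s0 := normr_ge0 s.
  rewrite /B in tB *; move: `|al| `|D| `|be| `|s| `|t| b0 a0 d0 s0 tB => /=.
  clear -p1 ap xp.
  nia.
have reach_bound (s : reachable_state trans be) : `|sval s| <= B.
  case: s => s [w /= <-]; elim/last_ind: w => [|w a IHw] /=.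
    by rewrite /B lerDr addr_ge0.
  by rewrite foldl_rcons bound.
(* carries in [-B, B], shifted by B, inject into {0, ..., 2B} *)
(* carries in [-B, B], shifted by B, inject into {0, ..., 2B} *)
pose shift (s : aut_state A) := `|(sval s + B)%R|%N.
rewrite /finite_automaton; suff -> :
    [set: aut_state A] = shift @^-1` `I_(`|(B + B)%R|%N.+1).
  apply: finite_preimage (finite_II _) => s t _ _ est.
  apply: eq_sig_hprop => [x|]; first exact: Prop_irrelevance.
  have := reach_bound s; have := reach_bound t; move: est; rewrite /shift.
  by move: (sval s) (sval t); clear; lia.
apply/seteqP; split=> // s _; rewrite /shift /preimage /=.
by have := reach_bound s; move: (sval s); clear; lia.
Qed.

(** Once the input is constantly 0 the state evolves autonomously, and among
   finitely many states one must recur. *)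
Lemma automaton_fun_periodic (A : automaton p) (z : padic_int p) (N : nat) :
    finite_automaton A -> (forall i, (N <= i)%N -> z i = 0) ->
  exists M n : nat, (0 < n)%N /\ (forall i, (M <= i)%N ->
    automaton_fun A z (i + n)%N = automaton_fun A z i).
Proof.
move=> finA z0.
have [i [j [ij eij]]] : exists i j, (i < j)%N /\
    aut_run A z (N + i) = aut_run A z (N + j).
  apply: contrapT => nrep; apply: infinite_nat.
  have -> : [set: nat] = (fun i => aut_run A z (N + i)) @^-1` setT by [].
  apply: finite_preimage finA => i j _ _ eij; apply: contrapT => /eqP.
  rewrite neq_ltn => /orP[] lt_ij; apply: nrep; first by exists i, j.
  by exists j, i.
have runE k : aut_run A z (N + i + k) = aut_run A z (N + j + k).
  elim: k => [|k IHk]; first by rewrite !addn0.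
  by rewrite !addnS /= !z0 ?IHk // -addnA leq_addr.
exists (N + i)%N, (j - i)%N; split; first by rewrite subn_gt0.
move=> k Nik; rewrite /automaton_fun !z0; last 2 first.
- by rewrite (leq_trans _ Nik) // leq_addr.
- by rewrite (leq_trans (leq_trans _ Nik)) // leq_addr.
have -> : (k + (j - i) = N + j + (k - (N + i)))%N by lia.
by rewrite -runE subnKC.
Qed.

Lemma finite_automaton_rational_output (A : automaton p) (z : padic_int p) N :
    finite_automaton A -> (forall i, (N <= i)%N -> z i = 0) ->
  zp_rational (automaton_fun A z).
Proof.
move=> finA z0; have [M [n [n0 per]]] := automaton_fun_periodic finA z0.
exact: zp_rational_periodic n0 per.
Qed.

(** The outputs on the inputs 0 and 1 are q and c + q. *)
Lemma affine_finite_automaton_rational (A : automaton p) (c q : padic_int p) :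
    finite_automaton A ->
    (forall z, automaton_fun A z = zp_add (zp_mul c z) q) ->
  zp_rational c /\ zp_rational q.
Proof.
move=> finA fE.
pose zero : padic_int p := fun=> 0.
pose one : padic_int p := fun i => (i == 0%N)%:R.
have trunc0 k : zp_trunc zero k = 0%N by rewrite /zp_trunc big1.
have trunc1 k : (0 < k)%N -> zp_trunc one k = 1%N.
  have one0 : one 0%N = 1%N :> nat.
    by rewrite /one eqxx val_Fp_nat // modn_small // prime_gt1.
  by case: k => // k _; rewrite /zp_trunc big_ord_recl one0 big1.
have f0 : automaton_fun A zero = q.
  rewrite fE; apply: (zp_eq_trunc p_prime) => k.
  by rewrite zp_trunc_add // zp_trunc_mul // trunc0 muln0 mod0n modn_small ?zp_trunc_lt.
have qr : zp_rational q.
  by rewrite -f0; apply: (finite_automaton_rational_output (N := 0) finA).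
split=> //.
have : zp_rational (automaton_fun A one).
  by apply: (finite_automaton_rational_output (N := 1) finA) => -[|i].
move=> /(zp_rationalP p_prime)[D1 [C1 [co1 E1]]].
have /(zp_rationalP p_prime)[D2 [C2 [co2 E2]]] := qr.
apply/(zp_rationalP p_prime); exists (D1 * D2), (C1 * D2 - C2 * D1).
split; first by rewrite abszM coprimeMl co1.
case=> [|k]; first by rewrite expn0 dvd1z.
have /dvdzP[u uE] := E1 k.+1; have /dvdzP[v vE] := E2 k.+1.
move: uE; rewrite fE zp_trunc_add // zp_trunc_mul // trunc1 // muln1 modnDml -modz_nat PoszD.
set P := (p ^ k.+1)%N%:Z in vE *.
set ck := (zp_trunc c k.+1)%:Z; set qk := (zp_trunc q k.+1)%:Z in vE *.
have /dvdzP[t tE] : (P %| ((ck + qk) %% P)%Z - (ck + qk))%Z.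
  by apply/eqz_modP; rewrite modz_mod.
have -> : ((ck + qk) %% P)%Z = t * P + (ck + qk) by rewrite -tE; ring.
move=> uE; apply/dvdzP; exists (D2 * u - D1 * v - D1 * D2 * t).
have -> : C1 = D1 * (t * P + (ck + qk)) - u * P by rewrite -uE; ring.
have -> : C2 = D2 * qk - v * P by rewrite -vE; ring.
ring.
Qed.

Lemma affine_finite_automatonP (c q : padic_int p) :
  (exists A : automaton p, finite_automaton A /\
     forall z : padic_int p, automaton_fun A z = zp_add (zp_mul c z) q)
  <-> zp_rational c /\ zp_rational q.
Proof.
split=> [[A [finA fE]]|]; first exact: affine_finite_automaton_rational finA fE.
move=> [] /(zp_rationalP p_prime)[D1 [C1 [co1 E1]]].
move=> /(zp_rationalP p_prime)[D2 [C2 [co2 E2]]].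
apply: (affine_finite_automaton (D := D1 * D2) (al := C1 * D2) (be := D1 * C2)).
- by rewrite abszM coprimeMl co1.
- move=> k; rewrite [D1 * D2]mulrC -mulrA [C1 * D2]mulrC -mulrBr.
  exact: dvdz_mull.
- by move=> k; rewrite -mulrA -mulrBr dvdz_mull.
Qed.

End AffineAutomata.

(** * Cables on the torus *)

Section Cables.
Variables (R : realType) (a : int) (b : nat).
Hypotheses (b_gt0 : (0 < b)%N) (coab : coprime `|a| b).
Let slope : R := a%:~R / b%:R.

Let b_neq0 : b%:R != 0 :> R. Proof. by rewrite pnatr_eq0 -lt0n. Qed.

Lemma torus_pt_eqP (x y x' y' : R) :
  torus_pt (x, y) = torus_pt (x', y') <-> x - x' \is a Num.int /\ y - y' \is a Num.int.
Proof. by split=> [/torus_ptP/andP//|] [xx yy]; apply/torus_ptP/andP. Qed.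

Lemma torus_ptW (P : torus R -> Prop) :
  (forall x y, P (torus_pt (x, y))) -> forall u, P u.
Proof.
move=> Pxy u; rewrite -[u]generic_quotient.reprK.
by case: (generic_quotient.repr u) => x y; apply: Pxy.
Qed.

(** Clearing the denominator b turns the union over integers n of the lines
   y = slope (x + n) + e into one integrality condition: slope * n + k, with n
   and k integers, takes exactly the values in (1/b)Z. *)
Lemma cableP (e x y : R) :
  cable slope e (torus_pt (x, y)) <-> b%:R * (y - e) - a%:~R * x \is a Num.int.
Proof.
split=> [[t]|/intrP[n nE]].
  rewrite torus_pt_mod1 => /torus_pt_eqP[/intrP[n nE] /intrP[k kE]].
  apply/intrP; exists (b%:Z * k - a * n).
  rewrite rmorphB !rmorphM /= -nE -kE /slope.
  by rewrite -[(b%:Z)%:~R]/(b%:R : R); field.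
have [u _ /dvdzP[v vE]] := coprime_solve n b_gt0 coab.
exists (x + u%:R); rewrite torus_pt_mod1; apply/torus_pt_eqP; split.
  by rewrite opprD addrA subrr add0r rpredN natr_int.
have vR : (a%:~R * u%:R - n%:~R : R) = v%:~R * b%:R.
  by rewrite -[u%:R]/(u%:Z%:~R) -[b%:R]/(b%:Z%:~R) -!rmorphM -rmorphB vE.
suff -> : y - (slope * (x + u%:R) + e) = - v%:~R by rewrite rpredN intr_int.
apply: (mulfI b_neq0); rewrite mulrN [b%:R * v%:~R]mulrC -vR -nE /slope.
by field.
Qed.

(** Running y = b t over the line makes the second coordinate a t + e, so the
   curve closes up after unit time in t. *)
Lemma cable_line (e : R) :
  cable slope e = range (fun t : R => torus_pt (b%:R * t, a%:~R * t + e)).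
Proof.
rewrite predeqE => u; split=> [[y ->]|[t _ <-]].
  exists (y / b%:R) => //; rewrite torus_pt_mod1 /slope.
  by congr (torus_pt (_, _)); field.
by exists (b%:R * t); rewrite torus_pt_mod1 /slope; congr (torus_pt (_, _)); field.
Qed.

Lemma derive1_affine (u v : R) : derive1 (fun t : R => u * t + v) = cst u.
Proof.
apply/funext => t; rewrite derive1E.
by rewrite deriveD // deriveZ //= derive_id derive_cst addr0 /GRing.scale /= mulr1.
Qed.

Lemma smooth_affine (u v : R) : smooth (fun t : R => u * t + v).
Proof.
have d1 := derive1_affine u v.
have dn n : derive1n n.+2 (fun t : R => u * t + v) = cst 0.
  elim: n => [|n IHn].
    by rewrite !derive1nS derive1n0 d1; apply/funext => t; rewrite derive1_cst.
  by rewrite derive1nS IHn; apply/funext => t; rewrite derive1_cst.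
case=> [|[|n]] t; rewrite ?derive1n0 ?derive1n1 ?d1 ?dn //.
Qed.

(** Injectivity modulo 1 is Bezout: if b s and a s are integers with a and b
   coprime, then so is s. *)
Lemma torus_knot_cable (e : R) : torus_knot (cable slope e).
Proof.
exists (fun t => torus_pt (b%:R * t, a%:~R * t + e)); split; last exact: cable_line.
  move=> t0; exists (fun t => b%:R * t + 0), (fun t => a%:~R * t + e).
  split; [exact: smooth_affine|exact: smooth_affine| |].
    by move=> [+ _]; rewrite derive1_affine => /eqP; rewrite (negbTE b_neq0).
  by apply: (@filterE _ (nbhs t0)) => t; rewrite addr0.
move=> s t; split=> [/torus_pt_eqP[]|st].
  rewrite -mulrBr opprD addrACA subrr addr0 -mulrBr => /intrP[n nE] /intrP[k kE].
  have /coprimezP[[x y] /= xy1] : coprimez a b by [].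
  apply/intrP; exists (x * k + y * n).
  rewrite rmorphD !rmorphM /= -nE -kE !mulrA -mulrDl.
  by rewrite -[b%:R]/(b%:Z%:~R) -!rmorphM -rmorphD xy1 mul1r.
apply/torus_pt_eqP; rewrite -mulrBr opprD addrACA subrr addr0 -mulrBr.
by split; rewrite rpredM ?natr_int ?intr_int.
Qed.

(** By the integrality criterion, whether two cables share a point does not
   depend on the point: cables of equal slope are disjoint or equal. *)
Lemma cable_meet (e1 e2 : R) (u : torus R) :
  cable slope e1 u -> cable slope e2 u -> b%:R * (e1 - e2) \is a Num.int.
Proof.
elim/torus_ptW: u => x y /cableP h1 /cableP h2.
have -> : b%:R * (e1 - e2) =
    (b%:R * (y - e2) - a%:~R * x) - (b%:R * (y - e1) - a%:~R * x) by ring.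
exact: rpredB.
Qed.

Lemma eq_cableP (e1 e2 : R) :
  cable slope e1 = cable slope e2 <-> b%:R * (e1 - e2) \is a Num.int.
Proof.
split=> [eC|e12].
  apply: (cable_meet (u := torus_pt (0, e1))); first by apply/cableP; rewrite subrr !mulr0 subrr.
  by rewrite -eC; apply/cableP; rewrite subrr !mulr0 subrr.
have sub f g : b%:R * (f - g) \is a Num.int -> cable slope f `<=` cable slope g.
  move=> fg; elim/torus_ptW => x y /cableP h; apply/cableP.
  have -> : b%:R * (y - g) - a%:~R * x =
    (b%:R * (y - f) - a%:~R * x) + b%:R * (f - g) by ring.
  exact: rpredD.
apply/seteqP; split; apply: sub => //.
by rewrite -rpredN -mulrN opprB.
Qed.

End Cables.

(** * Limits, and p-adic integers with prescribed truncations *)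

Section Limits.
Variable R : realType.

(** Integers at distance less than 1 are equal, so a convergent sequence of
   integers is eventually constant. *)
Lemma cvg_int_attained (u : nat -> R) (l : R) :
  (forall i, u i \is a Num.int) -> u @ \oo --> l -> exists i, u i = l.
Proof.
move=> uZ /cvgrPdist_lt ul.
have near_l (e : R) : 0 < e -> exists N, forall i, (N <= i)%N -> `|l - u i| < e.
  by move=> e0; have [N _ Ne] := ul e e0; exists N => i Ni; apply: Ne.
have [|N NP] := near_l (1 / 2); first by lra.
exists N; apply/eqP; apply: contraT => uNl.
have [|N' N'P] := near_l `|l - u N|; first by rewrite normr_gt0 subr_eq0 eq_sym.
have h1 := NP _ (leq_maxl N N'); have h2 := N'P _ (leq_maxr N N').
have h3 := NP _ (leqnn N).
suff e : u (maxn N N') = u N by rewrite e ltxx in h2.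
apply/eqP; rewrite -subr_eq0; apply: contraT => /(norm_intr_ge1 (rpredB (uZ _) (uZ _))).
rewrite leNgt => /negP[].
by rewrite (le_lt_trans (ler_distD l _ _)) // distrC; lra.
Qed.

Lemma cvg_inv_expn (p : nat) (k : nat -> nat) : (1 < p)%N ->
  (forall i, (i <= k i)%N) -> (fun i => (p ^ k i)%N%:R^-1 : R) @ \oo --> (0 : R).
Proof.
move=> p1 ki; apply: (squeeze_cvgr _ (cvg_cst 0) (@cvg_harmonic R)).
apply: nearW => i; rewrite invr_ge0 ler0n /= lef_pV2 ?posrE ?ltr0n ?expn_gt0 //.
  by rewrite ler_nat (leq_ltn_trans (ki i)) // ltn_expl.
by rewrite (ltnW p1).
Qed.

Lemma homo_ltn_ge_id (k : nat -> nat) :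
  {homo k : i j / (i < j)%N} -> forall i, (i <= k i)%N.
Proof. by move=> kh; elim=> // i IHi; apply: leq_ltn_trans IHi (kh _ _ _). Qed.

Lemma cvg_subseq (u : nat -> R) (l : R) (f : nat -> nat) :
  {homo f : i j / (i < j)%N} -> u @ \oo --> l -> (fun i => u (f i)) @ \oo --> l.
Proof.
move=> f_incr ul; apply: cvg_comp ul => P [N _ NP]; exists N => // i /= Ni; apply: NP.
exact: leq_trans Ni (homo_ltn_ge_id f_incr i).
Qed.

End Limits.

Section DigitBlocks.
Variables (R : realType) (p : nat) (p_prime : prime p) (b : nat).
Hypotheses (b_gt0 : (0 < b)%N) (cobp : coprime b p).
Variables (x : R).
Hypothesis x01 : 0 <= x < 1.

(** The new block w of d digits is floor(x p^d), moved to the class modulo b that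
   u dictates; the old digits Z contribute at most 1 / p^d. *)
Lemma approx_block (k d Z u : nat) : (b <= p ^ d)%N -> (Z < p ^ k)%N ->
  exists Z' : nat,
    [/\ (Z' < p ^ (k + d))%N, Z' = Z %[mod p ^ k], (b %| Z'%:Z - u%:Z)%Z &
        `|Z'%:R / (p ^ (k + d))%N%:R - x| <= (2 * b + 2)%:R / (p ^ d)%N%:R].
Proof.
move=> bd Zk.
have co : coprime `|(p ^ k)%N%:Z| b by rewrite coprimeXl // coprime_sym.
have [r rb dvd_r] := coprime_solve (u%:Z - Z%:Z) b_gt0 co.
have P0 : (0 < p ^ d)%N by rewrite expn_gt0 prime_gt0.
have Q0 : (0 < p ^ k)%N by rewrite expn_gt0 prime_gt0.
move: x01 => /andP[x0 x1].
pose w0 := Num.truncn (x * (p ^ d)%N%:R).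
have /andP[w0l w0u] : w0%:R <= x * (p ^ d)%N%:R < w0.+1%:R.
  by apply: truncn_itv; rewrite mulr_ge0.
have w0P : (w0 < p ^ d)%N.
  by rewrite -(ltr_nat R) (le_lt_trans w0l) // gtr_pMl // ltr0n.
(* rounding down by one more multiple of b keeps w below p^d; when w0 < b, the
   truncated predecessor leaves w = r < b <= p^d *)
pose w := (b * (w0 %/ b).-1 + r)%N.
have w0E := divn_eq w0 b; have w0m := ltn_pmod w0 b_gt0.
have wP : (w < p ^ d)%N.
  by rewrite /w; move: (w0 %/ b)%N (w0 %% b)%N w0E w0m => [|s] t /=; nia.
have ww0 : (w <= w0 + b)%N.
  by rewrite /w; move: (w0 %/ b)%N (w0 %% b)%N w0E w0m => [|s] t /=; nia.
have w0w : (w0 <= w + 2 * b)%N.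
  by rewrite /w; move: (w0 %/ b)%N (w0 %% b)%N w0E w0m => [|s] t /=; nia.
exists (Z + p ^ k * w)%N; split.
- by rewrite expnD; nia.
- by rewrite addnC mulnC modnMDl.
- have /dvdzP[s sE] := dvd_r; apply/dvdzP.
  exists (s + (p ^ k)%N%:Z * (w0 %/ b).-1%:Z).
  rewrite /w !PoszD !PoszM PoszD PoszM [RHS]mulrDl -sE; ring.
have PR : 0 < (p ^ d)%N%:R :> R by rewrite ltr0n.
have QR : 0 < (p ^ k)%N%:R :> R by rewrite ltr0n.
have -> : (Z + p ^ k * w)%N%:R / (p ^ (k + d))%N%:R - x =
    (Z%:R / (p ^ k)%N%:R + w%:R - x * (p ^ d)%N%:R) / (p ^ d)%N%:R.
  rewrite expnD natrD !natrM; move: PR QR.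
  move: ((p ^ d)%N%:R : R) ((p ^ k)%N%:R : R) => P Q PR QR.
  by field; rewrite !gt_eqF.
rewrite normrM [`|_^-1|]gtr0_norm ?invr_gt0 // ler_pM2r ?invr_gt0 //.
have Zl : 0 <= Z%:R / (p ^ k)%N%:R :> R by rewrite divr_ge0.
have Zu : Z%:R / (p ^ k)%N%:R <= 1 :> R.
  by rewrite ler_pdivrMr // mul1r ler_nat ltnW.
move: ww0 w0w; rewrite -!(ler_nat R) !natrD natrM => ww0 w0w.
move: w0u; rewrite -addn1 natrD => w0u.
have b0 : 0 <= b%:R :> R by [].
by rewrite ler_norml; apply/andP; split; lra.
Qed.

(** Blocks of lengths d 0, d 1, ... glued into a single p-adic integer: each of
   its truncations at a block end approximates x and lies in its own prescribed
   class modulo b. *)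
Lemma approx_padic (k d u : nat -> nat) :
    (forall i, k i.+1 = (k i + d i)%N) -> (forall i, (0 < d i)%N) ->
    (forall i, (b <= p ^ d i)%N) ->
  exists z : padic_int p, forall i,
    (b %| (zp_trunc z (k i.+1))%:Z - (u i)%:Z)%Z /\
    `|(zp_trunc z (k i.+1))%:R / (p ^ k i.+1)%N%:R - x|
      <= (2 * b + 2)%:R / (p ^ d i)%N%:R.
Proof.
move=> kS d0 bd.
(* the hypothesis on Z stays inside the existential so that choice yields a
   total step function *)
have step (s : nat * nat) : exists Z' : nat, (s.2 < p ^ k s.1)%N ->
    [/\ (Z' < p ^ k s.1.+1)%N, Z' = s.2 %[mod p ^ k s.1], (b %| Z'%:Z - (u s.1)%:Z)%Z &
        `|Z'%:R / (p ^ k s.1.+1)%N%:R - x| <= (2 * b + 2)%:R / (p ^ d s.1)%N%:R].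
  case: s => i Z /=; case: (ltnP Z (p ^ k i)) => [Zk|_]; last by exists 0%N.
  have [Z' Z'P] := approx_block (u i) (bd i) Zk.
  by exists Z'; rewrite kS.
have [F FP] := choice step.
pose Z := fix Z i := if i is j.+1 then F (j, Z j) else 0%N.
have Zlt i : (Z i < p ^ k i)%N.
  elim: i => [|i IHi] /=; first by rewrite expn_gt0 prime_gt0.
  by have [] := FP (i, Z i) IHi.
have {FP} ZP i := FP (i, Z i) (Zlt i).
have ik : forall i, (i <= k i)%N.
  by elim=> // i IHi; rewrite kS; have := d0 i; lia.
have Zcoh i j : (i <= j)%N -> Z j = Z i %[mod p ^ k i].
  elim: j => [|j IHj]; first by rewrite leqn0 => /eqP ->.
  rewrite leq_eqVlt => /predU1P[-> //|]; rewrite ltnS => ij; rewrite -(IHj ij).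
  have [_ e _ _] := ZP j; rewrite -/(Z j.+1) /= in e.
  have kij : (k i <= k j)%N.
    move: ij; clear -kS; elim: j => [|j IHj]; first by rewrite leqn0 => /eqP ->.
    by rewrite leq_eqVlt => /predU1P[-> //|/IHj]; rewrite kS => /leq_trans; apply; apply: leq_addr.
  by rewrite -(modn_dvdm (Z j) (dvdn_exp2l p kij)) -e modn_dvdm // dvdn_exp2l.
exists (zp_of_residues p Z) => i.
have -> : zp_trunc (zp_of_residues p Z) (k i.+1) = Z i.+1.
  rewrite zp_trunc_of_residues // => [|j].
    by rewrite (Zcoh i.+1) // modn_small.
  have e := Zcoh j j.+1 (leqnSn j).
  by rewrite -(modn_dvdm (Z j.+1) (dvdn_exp2l p (ik j))) e modn_dvdm // dvdn_exp2l.
by have [_ _ h1 h2] := ZP i.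
Qed.

End DigitBlocks.

(** * The limit plot of an affine automaton *)

Section AffineLimitPlot.
Variables (R : realType) (p : nat) (p_prime : prime p) (A : automaton p).
Variables (a a' : int) (b b' : nat).
Hypotheses (b_gt0 : (0 < b)%N) (b'_gt0 : (0 < b')%N).
Hypotheses (coab : coprime `|a| b) (cobp : coprime b p) (cob'p : coprime b' p).
Hypothesis fE : forall (z : padic_int p) (k : nat),
  ((p ^ k)%N %| b%:Z * b'%:Z * (zp_trunc (automaton_fun A z) k)%:Z
    - (a * b'%:Z * (zp_trunc z k)%:Z + a' * b%:Z))%Z.
Let slope : R := a%:~R / b%:R.
Let q : R := a'%:~R / b'%:R.
Let ord := mult_order b' p.

Let b_neq0 : b%:R != 0 :> R. Proof. by rewrite pnatr_eq0 -lt0n. Qed.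
Let b'_neq0 : b'%:R != 0 :> R. Proof. by rewrite pnatr_eq0 -lt0n. Qed.

Let pX_gt0 k : (0 < p ^ k)%N. Proof. by rewrite expn_gt0 prime_gt0. Qed.
Let pXR_neq0 k : (p ^ k)%N%:R != 0 :> R. Proof. by rewrite pnatr_eq0 -lt0n. Qed.

Let natz_intr (n : nat) : (n%:Z)%:~R = n%:R :> R. Proof. by []. Qed.

Let expn_inv_mod k l : (ord %| k + l)%N ->
  exists s : int, (p ^ k)%N%:Z * (p ^ l)%N%:Z = 1 + s * b'%:Z.
Proof.
move=> dvd_kl.
have /dvdzP[s sE] : (b' %| (p ^ (k + l))%N%:Z - (p ^ 0)%N%:Z)%Z.
  by apply/mult_orderP => //; rewrite mod0n; apply/eqP.
by exists s; rewrite -PoszM -expnD -sE expn0; ring.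
Qed.

(** Along the sequence, b' (b Y - a X) - a' b / p^k is an integer T. The limit
   b' (b y - a x) is thus one of the T, and the class of T modulo b' identifies
   the cable. *)
Lemma limit_plot_sub_cables (x y : R) : limit_plot_plane R A (x, y) ->
  exists l : nat, cable slope (- (p%:R ^+ l * q)) (torus_pt (x, y)).
Proof.
move=> [z [k [_ k_incr /= zx fy]]].
set X := (fun i => _) in zx; set Y := (fun i => _) in fy.
have kz i := fE z (k i).
pose T i : R := b'%:R * (b%:R * Y i - a%:~R * X i) - a'%:~R * b%:R * (p ^ k i)%N%:R^-1.
have T_int i : exists2 t : int, T i = t%:~R &
    t * (p ^ k i)%N%:Z = b%:Z * b'%:Z * (zp_trunc (automaton_fun A z) (k i))%:Z
      - (a * b'%:Z * (zp_trunc z (k i))%:Z + a' * b%:Z).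
  have /dvdzP[t tE] := kz i; exists t => //.
  apply: (mulIf (pXR_neq0 (k i))); rewrite -[X in _ = _ * X]natz_intr -rmorphM -tE.
  rewrite rmorphB rmorphD !rmorphM /= !natz_intr /T /X /Y.
  have := pXR_neq0 (k i); move: ((p ^ k i)%N%:R : R) => P P0.
  by field.
have T_cvg : T @ \oo --> b'%:R * (b%:R * y - a%:~R * x) - a'%:~R * b%:R * 0.
  apply: cvgB; apply: cvgM; try exact: cvg_cst.
    by apply: cvgB; apply: cvgM => //; exact: cvg_cst.
  exact: (cvg_inv_expn (prime_gt1 p_prime) (homo_ltn_ge_id k_incr)).
have [|i] := cvg_int_attained _ T_cvg; first by move=> i; have [t ->] := T_int i.
have [t -> tE] := T_int i; rewrite mulr0 subr0 => txy.
(* (ord - 1) k = - k modulo ord *)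
pose l := ((ord.-1) * k i)%N.
have [|s sE] := @expn_inv_mod (k i) l.
  by rewrite /l -mulSn prednK ?mult_order_gt0 // dvdn_mulr.
exists l; apply/(cableP b_gt0 coab).
(* t p^k = - a' b modulo b', and p^l inverts p^k modulo b' *)
have [r rE] : exists r : int, t + b%:Z * a' * (p ^ l)%N%:Z = r * b'%:Z.
  move: tE sE; move: (zp_trunc (automaton_fun A z) (k i)) (zp_trunc z (k i)) => g h.
  move: (p ^ k i)%N%:Z (p ^ l)%N%:Z => P L tE sE.
  exists (L * (b%:Z * g%:Z - a * h%:Z) - t * s).
  have e : t = t * P * L - t * s * b'%:Z by rewrite -mulrA sE; ring.
  by rewrite {1}e tE; ring.
apply/intrP; exists r; apply: (mulIf b'_neq0).
rewrite -[X in _ = _ * X]natz_intr -rmorphM -rE rmorphD !rmorphM /= !natz_intr txy natrX.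
rewrite /q; move: (p%:R ^+ l) => L; move: b'_neq0.
move: (b'%:R : R) (b%:R : R) (a%:~R : R) (a'%:~R : R) => B' B a1 a2 B0.
by field.
Qed.

(** The block ends k satisfy k = - l modulo the order of p modulo b', which
   selects the cable, and z_k solves a z_k = - n p^k modulo b, where
   n = b (y + p^l q) - a x, which selects the strand of this cable through
   (x, y). The abscissa is taken in [0, 1),
   where truncations divided by p^k live; the ordinate y' found by compactness
   may differ from y by an integer. *)
Lemma cables_sub_limit_plot (x y : R) (l : nat) : 0 <= x < 1 ->
  cable slope (- (p%:R ^+ l * q)) (torus_pt (x, y)) ->
  exists y' : R, limit_plot_plane R A (x, y') /\ y' - y \is a Num.int.
Proof.
move=> x01 /(cableP b_gt0 coab)/intrP[n nE].
have ord0 : (0 < ord)%N := mult_order_gt0 b' p.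
pose d i := (ord * (b + i))%N.
(* (ord - 1) l = - l modulo ord, and the block lengths are multiples of ord *)
pose k := fix k i := if i is j.+1 then (k j + d j)%N else ((ord.-1) * l)%N.
have ord_k i : (ord %| k i + l)%N.
  elim: i => [|i IHi] /=; first by rewrite addnC -mulSn prednK // dvdn_mulr.
  by rewrite addnAC dvdn_addr // dvdn_mulr.
have d0 i : (0 < d i)%N by rewrite /d muln_gt0 ord0 addn_gt0 b_gt0.
have bid i : (b + i <= d i)%N by rewrite leq_pmull.
have p1 := prime_gt1 p_prime.
have bd i : (b <= p ^ d i)%N.
  rewrite (leq_trans (ltnW (ltn_expl b p1))) // leq_exp2l //.
  by rewrite (leq_trans _ (bid i)) // leq_addr.
have target i : exists u : nat, (b %| a * u%:Z - - (n * (p ^ k i.+1)%N%:Z))%Z.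
  by have [u _ uP] := coprime_solve (- (n * (p ^ k i.+1)%N%:Z)) b_gt0 coab; exists u.
have [u uP] := choice target.
have [z zP] := approx_padic p_prime b_gt0 cobp x01 (k := k) u (fun=> erefl) d0 bd.
pose X i : R := (zp_trunc z (k i.+1))%:R / (p ^ k i.+1)%N%:R.
pose Y i : R := (zp_trunc (automaton_fun A z) (k i.+1))%:R / (p ^ k i.+1)%N%:R.
have Xx : X @ \oo --> x.
  have cvg0 : (fun i => (2 * b + 2)%:R * (p ^ d i)%N%:R^-1 : R) @ \oo --> (0 : R).
    rewrite -[X in _ --> X](mulr0 ((2 * b + 2)%:R : R)); apply: cvgM; first exact: cvg_cst.
    apply: cvg_inv_expn => // i.
    by rewrite (leq_trans _ (bid i)) // leq_addl.
  apply/cvgrPdist_le => e e0; move/cvgrPdist_le: cvg0 => /(_ e e0).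
  apply: filterS => i; rewrite sub0r normrN ger0_norm ?mulr_ge0 ?invr_ge0 //.
  by rewrite distrC; apply: le_trans; have [_] := zP i.
have XY i : Y i - (slope * X i + q * (p ^ k i.+1)%N%:R^-1 - p%:R ^+ l * q + n%:~R / b%:R)
    \is a Num.int.
  set K := k i.+1; set P := (p ^ K)%N%:Z.
  have /dvdzP[t tE] := fE z K; have [s sE] := expn_inv_mod (ord_k i.+1).
  have [/dvdzP[v vE] _] := zP i; have /dvdzP[w wE] := uP i.
  move: tE sE vE wE; rewrite -/K -/P.
  rewrite /Y /X -/K -natrX -!natz_intr -/P.
  have : P%:~R != 0 :> R by rewrite natz_intr.
  have coP : coprimez P (b%:Z * b'%:Z).
    by apply: coprimez_expr_prime; rewrite abszM coprimeMl cobp.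
  move: coP.
  move: (zp_trunc (automaton_fun A z) K)%:Z (zp_trunc z K)%:Z => g h.
  move: P (p ^ l)%N%:Z => P L coP P0 tE sE vE wE.
  have hE : a * h + n * P = (w + a * v) * b%:Z.
    have -> : h = (u i)%:Z + v * b%:Z by rewrite -vE; ring.
    have -> : (w + a * v) * b%:Z = w * b%:Z + a * v * b%:Z by ring.
    by rewrite -wE; ring.
  move: hE; move: (w + a * v) => m hE.
  (* the identity is divided by b b', which is prime to P = p^K *)
  have [N NE] : exists N : int, g - m + a' * s = N * P.
    apply/dvdzP; rewrite -(Gauss_dvdzr _ coP).
    apply/dvdzP; exists (t + a' * b%:Z * L - n * b'%:Z).
    transitivity (b%:Z * b'%:Z * g - b'%:Z * (m * b%:Z)
      + a' * b%:Z * (1 + s * b'%:Z) - a' * b%:Z).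
      by ring.
    rewrite -sE -hE [RHS]mulrBl [in RHS]mulrDl -tE; ring.
  apply/intrP; exists N.
  have gE : b%:Z * b'%:Z * g - a * b'%:Z * h - a' * b%:Z + L * a' * b%:Z * P
      - n * b'%:Z * P = N * (b%:Z * b'%:Z * P).
    transitivity (b%:Z * b'%:Z * g - b'%:Z * (a * h + n * P)
      + a' * b%:Z * (P * L) - a' * b%:Z).
      by ring.
    transitivity (b%:Z * b'%:Z * (N * P)); last by ring.
    by rewrite hE sE -NE; ring.
  have := congr1 (intr : int -> R) gE.
  rewrite rmorphB rmorphD !rmorphB !rmorphM /= !natz_intr => gR.
  have BP0 : b%:R * b'%:R * P%:~R != 0 :> R by rewrite !mulf_neq0.
  apply: (mulIf BP0); rewrite -gR /slope /q; move: P0 b_neq0 b'_neq0.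
  move: (P%:~R : R) (b%:R : R) (b'%:R : R) => P1 b1 b1' P10 b10 b1'0.
  by field; rewrite P10 b10 b1'0.
have Ybnd : bounded_fun Y.
  exists 1; split=> // M M1 i _ /=; rewrite ger0_norm ?divr_ge0 //.
  rewrite (le_trans _ (ltW M1)) // ler_pdivrMr ?ltr0n // mul1r ler_nat ltnW //.
  exact: zp_trunc_lt.
have [f f_incr /cvg_ex[y' Yy']] := bolzano_weierstrass Ybnd.
have f_homo : {homo f : i j / (i < j)%N}.
  by move=> i j; rewrite !ltnNge; apply: contraNN => ji; rewrite -(f_incr j i).
have k_homo : {homo k : i j / (i < j)%N}.
  by apply: homo_ltn; [exact: ltn_trans|move=> i /=; rewrite -addn1 leq_add2l].
exists y'; split.
  exists z, (fun i => k (f i).+1); split.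
  - by move=> i; rewrite (leq_trans _ (homo_ltn_ge_id k_homo _)).
  - by move=> i j ij; apply: k_homo; rewrite ltnS f_homo.
  - exact: cvg_subseq f_homo Xx.
  - exact: Yy'.
have lim : (fun i => Y (f i) - (slope * X (f i) + q * (p ^ k (f i).+1)%N%:R^-1
    - p%:R ^+ l * q + n%:~R / b%:R)) @ \oo -->
    y' - (slope * x + q * 0 - p%:R ^+ l * q + n%:~R / b%:R).
  apply: cvgB Yy' _; apply: cvgD; last exact: cvg_cst.
  apply: cvgB; last exact: cvg_cst.
  apply: cvgD; apply: cvgM; try exact: cvg_cst; first exact: cvg_subseq f_homo Xx.
  apply: cvg_inv_expn => // i.
  by rewrite (leq_trans (homo_ltn_ge_id f_homo i)) // (leq_trans (leqnSn _)) // homo_ltn_ge_id.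
have [i iE] := cvg_int_attained (fun i => XY (f i)) lim.
have -> : y' - y = y' - (slope * x + q * 0 - p%:R ^+ l * q + n%:~R / b%:R).
  rewrite -nE /slope; move: b_neq0; move: (b%:R : R) (p%:R ^+ l * q) => B L B0.
  by field.
by rewrite -iE.
Qed.

Lemma limit_plot_cables :
  limit_plot R A = [set u | exists l : nat, cable slope (- (p%:R ^+ l * q)) u].
Proof.
apply/seteqP; split=> u.
  by move=> [[x y] /limit_plot_sub_cables xy <-].
elim/torus_ptW: u => x y [l lxy].
have xE : torus_pt (x, y) = torus_pt (mod1 x, y).
  by apply/torus_pt_eqP; rewrite /mod1 subrr opprB addrCA subrr addr0 intr_int.
rewrite xE in lxy *.
have x01 : 0 <= mod1 x < 1.
  have /andP[le_floor lt_floor] := floor_itv x.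
  by move: lt_floor; rewrite /mod1 subr_ge0 le_floor /= rmorphD /= => ?; lra.
have [y' [xy' yy']] := cables_sub_limit_plot x01 lxy.
by exists (mod1 x, y') => //; apply/torus_pt_eqP; rewrite subrr.
Qed.


End AffineLimitPlot.
(** * Counting the cables *)

Lemma frac_denq (r : rat) (a : int) (b : nat) :
  (0 < b)%N -> r = a%:~R / b%:R -> a * denq r = numq r * b%:Z.
Proof.
move=> b0 rE; apply/eqP; rewrite -(eqr_int rat) !rmorphM /=.
by rewrite -eqr_div ?intr_eq0 ?denq_eq0 -?lt0n // divq_num_den [(b%:Z)%:~R]/(b%:R) -rE.
Qed.

Lemma ratr_frac (R : realType) (a : int) (b : nat) :
  ratr (a%:~R / b%:R) = a%:~R / b%:R :> R.
Proof. by rewrite fmorph_div rmorph_int rmorph_nat. Qed.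

(** After cancelling g = gcd(b, b'), the factor (b / g) a' is prime to
   m = b' / g, so m must divide the difference of the powers of p. *)
Lemma shift_diff_int (R : realType) (p b b' : nat) (a' : int) (r1 r2 : nat) :
    (0 < b)%N -> (0 < b')%N -> coprime `|a'| b' -> coprime b' p ->
  (b%:R * (- (p%:R ^+ r1 * (a'%:~R / b'%:R)) - - (p%:R ^+ r2 * (a'%:~R / b'%:R))) : R)
    \is a Num.int <-> r1 = r2 %[mod mult_order (b' %/ gcdn b b') p].
Proof.
move=> b0 b'0 coa' cob'p.
set g := gcdn b b'; have g0 : (0 < g)%N by rewrite gcdn_gt0 b0.
have gb : (g %| b)%N := dvdn_gcdl b b'; have gb' : (g %| b')%N := dvdn_gcdr b b'.
set m := (b' %/ g)%N; have mE : b' = (m * g)%N by rewrite divnK.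
have mb' : (m %| b')%N by rewrite mE dvdn_mulr.
have m0 : (0 < m)%N by rewrite divn_gt0 // dvdn_leq.
rewrite -(mult_orderP _ _ m0 (coprime_dvdl mb' cob'p)).
set d := (p ^ r1)%N%:Z - (p ^ r2)%N%:Z.
pose beta := (b %/ g)%N; have bE : b = (beta * g)%N by rewrite divnK.
have co_m_beta : coprime m beta.
  by rewrite /coprime -(eqn_pmul2r g0) muln_gcdl -mE -bE mul1n gcdnC.
have co : coprimez m (beta%:Z * a').
  rewrite /coprimez -[_ == _]/(coprime m `|beta%:Z * a'|) abszM coprimeMr.
  by rewrite co_m_beta coprime_sym (coprime_dvdr mb' coa').
have b'R : b'%:R != 0 :> R by rewrite pnatr_eq0 -lt0n.
set D := (X in X \is a _); have DE : D * b'%:R = - (b%:Z * a' * d)%:~R.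
  rewrite !rmorphM rmorphB /= -[((p ^ r1)%N%:Z)%:~R]/((p ^ r1)%N%:R : R).
  rewrite -[((p ^ r2)%N%:Z)%:~R]/((p ^ r2)%N%:R : R) !natrX -[(b%:Z)%:~R]/(b%:R : R).
  rewrite /D; move: b'R; move: (p%:R ^+ r1 : R) (p%:R ^+ r2 : R) (b'%:R : R) => x y z z0.
  by field.
have -> : (D \is a Num.int) = (b' %| b%:Z * a' * d)%Z.
  apply/intrP/dvdzP => -[n nE].
    exists (- n); apply/eqP; rewrite -(eqr_int R) -eqr_opp -DE nE rmorphM rmorphN /=.
    by rewrite mulNr opprK.
  exists (- n); apply: (mulIf b'R); rewrite DE nE rmorphM rmorphN /=.
  by rewrite mulNr.
have -> : (b' %| b%:Z * a' * d)%Z = (m %| beta%:Z * a' * d)%Z.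
  rewrite mE bE !PoszM -[in RHS](@dvdz_mul2r g%:Z) ?eqz_nat -?lt0n //.
  by congr (_ %| _)%Z; ring.
by rewrite Gauss_dvdzr.
Qed.

Lemma mod1_int (R : realType) (y : R) : mod1 y - y \is a Num.int.
Proof. by rewrite /mod1 addrAC subrr add0r rpredN intr_int. Qed.

Theorem theorem3p9 (R : realType) (p : nat) (p_prime : prime p) :
  (forall c q : padic_int p,
     (exists A : automaton p, finite_automaton A /\
        forall z : padic_int p, automaton_fun A z = zp_add (zp_mul c z) q)
     <-> zp_rational c /\ zp_rational q)
  /\
  (forall (A : automaton p) (c q : rat) (cp qp : padic_int p)
          (a a' : int) (b b' : nat),
     finite_automaton A ->
     zp_is_rat cp c -> zp_is_rat qp q ->
     (forall z : padic_int p, automaton_fun A z = zp_add (zp_mul cp z) qp) ->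
     (0 < b)%N -> (0 < b')%N ->
     c = a%:~R / b%:R -> q = a'%:~R / b'%:R ->
     coprime `|a|%N b -> coprime `|a'|%N b' ->
     coprime b p -> coprime b' p ->
     let m := (b' %/ gcdn b b')%N in
     [/\ exists K : 'I_(mult_order m p) -> set (torus R),
           [/\ torus_link K,
               limit_plot R A = \bigcup_(i in [set: 'I_(mult_order m p)]) K i &
               forall i, exists2 e : R,
                 cable_shifts R p q e & K i = cable (ratr c) e],
         limit_plot R A =
           [set P | exists y e : R, cable_shifts R p q e /\
              P = torus_pt (mod1 y, mod1 (ratr c * y + e))] &
         forall (e1 e2 : R) (r1 r2 : nat),
           cable_shifts R p q e1 -> cable_shifts R p q e2 ->
           e1 = mod1 (- (p%:R ^+ r1 * ratr q)) ->
           e2 = mod1 (- (p%:R ^+ r2 * ratr q)) ->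
           cable (ratr c) e1 = cable (ratr c) e2
           <-> r1 = r2 %[mod mult_order m p] ]).
Proof.
split; first exact: affine_finite_automatonP.
move=> A c q cp qp a a' b b' _ cpc qpq fE b0 b'0 cE qE coab coa'b' cobp cob'p m.
have {}fE z k : ((p ^ k)%N %| b%:Z * b'%:Z * (zp_trunc (automaton_fun A z) k)%:Z
    - (a * b'%:Z * (zp_trunc z k)%:Z + a' * b%:Z))%Z.
  rewrite fE; apply: zp_affine_trunc => //.
    by apply: zp_is_rat_solves cpc _; rewrite mulrAC (frac_denq b0 cE) mulrA.
  apply: zp_is_rat_solves qpq _.
  by rewrite mulrAC (frac_denq b'0 qE) [b%:Z * _]mulrC mulrA.
have eq_shift r1 r2 :
    cable (ratr c) (mod1 (- (p%:R ^+ r1 * ratr q)) : R) =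
    cable (ratr c) (mod1 (- (p%:R ^+ r2 * ratr q)))
    <-> r1 = r2 %[mod mult_order m p].
  rewrite cE qE !ratr_frac eq_cableP // -(shift_diff_int R _ _ b0 b'0 coa'b' cob'p).
  set e1 := - _; set e2 := - (_ * _).
  have -> : b%:R * (mod1 e1 - mod1 e2) =
      b%:R * (mod1 e1 - e1) - b%:R * (mod1 e2 - e2) + b%:R * (e1 - e2) by ring.
  have mod1Z (e : R) : b%:R * (mod1 e - e) \is a Num.int.
    by rewrite rpredM ?mod1_int ?natr_int.
  by rewrite rpredDl // rpredB.
have mod1_cable e : cable (ratr c) (mod1 e : R) = cable (ratr c) e.
  by rewrite cE ratr_frac eq_cableP // rpredM ?mod1_int ?natr_int.
have LP : limit_plot R A =
    [set u | exists l, cable (ratr c) (mod1 (- (p%:R ^+ l * ratr q))) u].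
  rewrite (limit_plot_cables R p_prime b0 b'0 coab cobp cob'p fE).
  by apply/seteqP; split=> u [l ul]; exists l; move: ul;
    rewrite mod1_cable cE qE !ratr_frac.
have ord0 : (0 < mult_order m p)%N := mult_order_gt0 m p.
split.
- exists (fun i => cable (ratr c) (mod1 (- (p%:R ^+ i * ratr q)))); split.
  + split=> [i|i j ij]; first by rewrite cE ratr_frac; apply: torus_knot_cable.
    apply/seteqP; split=> // u [ui uj]; apply: ij; apply: val_inj.
    have : cable (ratr c) (mod1 (- (p%:R ^+ i * ratr q)) : R) =
        cable (ratr c) (mod1 (- (p%:R ^+ j * ratr q))).
      move: ui uj; rewrite cE ratr_frac => ui uj; apply/(eq_cableP b0 coab).
      exact (cable_meet b0 coab ui uj).
    by move/eq_shift; rewrite !modn_small.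
  + rewrite LP; apply/seteqP; split=> [u [l ul]|u [i _ ui]]; last by exists i.
    exists (Ordinal (ltn_pmod l ord0)) => //=.
    by rewrite (_ : cable _ _ = cable (ratr c) (mod1 (- (p%:R ^+ l * ratr q)))) //;
      apply/eq_shift; rewrite modn_mod.
  + by move=> i; exists (mod1 (- (p%:R ^+ i * ratr q))) => //; exists i.
- rewrite LP; apply/seteqP; split=> u.
    by move=> [l [y ->]]; exists y, (mod1 (- (p%:R ^+ l * ratr q))); split=> //; exists l.
  by move=> [y [_ [[l ->] ->]]]; exists l, y.
- by move=> _ _ r1 r2 _ _ -> ->; exact: eq_shift.
Qed.
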